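(* Let $\ell$ be a positive integer and $k$ be a prime number greater than $\ell$. Then, for any real number $x\geq k(k+1)$, we have \[\theta(x;k,\ell)\leq x\left(\frac{2c_3}{k}+\frac{\log k}{k-1}\right),\] where $c_3=1.25507$.
   Context: For a real $x>0$ and positive integers $k,\ell$, $\theta(x;k,\ell):=\sum \log p$, where the sum is over all prime numbers $p\leq x$ belonging to the arithmetic progression $\ell,\ell+k,\ell+2k,\dots$ of first term $\ell$ and common difference $k$. $\log$ is the natural logarithm. *)

(* Defs.v *)
(* Real numbers: an arbitrary R : realType of MathComp-Analysis. *)
From mathcomp Require Import all_boot all_order all_algebra.
From mathcomp Require Import reals exp.

Set Implicit Arguments.
Unset Strict Implicit.
Unset Printing Implicit Defensive.

Import Order.TTheory GRing.Theory Num.Theory.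
Local Open Scope ring_scope.

(* For 0 <= x, the natural numbers p <= x are those with p <= Num.truncn x.
   The test l <= p is needed because the progression l, l + k, l + 2k, ...
   is the part of the residue class of l modulo k that starts at l. *)
Definition theta (R : realType) (x : R) (k l : nat) : R :=
  \sum_(0 <= p < (Num.truncn x).+1
       | [&& prime p, (l <= p)%N & p == l %[mod k]]) ln p%:R.

(* The number 1.25507, written digit by digit because numerals of a ring are
   unary and 125507 would overflow the stack. *)
Definition c3 (R : realType) : R :=
  1 + 2 / 10 + 5 / 10 ^+ 2 + 5 / 10 ^+ 3 + 0 / 10 ^+ 4 + 7 / 10 ^+ 5.

(* Main.v *)
Require Import Defs.
From mathcomp Require Import all_boot all_order all_algebra.
From mathcomp Require Import reals exp.
From mathcomp Require Import zify ring lra.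
Import Order.TTheory GRing.Theory Num.Theory.
Local Open Scope ring_scope.

(** Let X be the integer part of x and N = (X - l) %/ k.  The primes p = l + j k
counted by theta are split at N.

Those with p <= N are handled by the classical primorial bound
[primorial_le]: their product is at most 4 ^ N.

Those with p > N are handled by a Chebyshev argument in the progression.
Since l <= N, such a p is l + j k with 1 <= j <= N, so it divides the product
A of the l + j k for 1 <= j <= N.  The part d of N! that is prime to k divides
A as well: k is invertible modulo d, so modulo d the progression is k times a
run of N consecutive integers, whose product is a multiple of N!.  Primes above
N are coprime to d, hence the product B of the large primes satisfies
B * d <= A <= k ^ N * (N + 1)!, that is B <= k ^ N * (N + 1) * k ^ v with v the
exponent of k in N!, and v <= N / (k - 1) by Legendre's formula
([prod_large_primes_le], [logn_fact_le]).

Taking logarithms,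
  theta x k l <= N ln 4 + ln (N + 1) + N ln k (1 + 1 / (k - 1)).
As N <= x / k, the last term is at most x ln k / (k - 1), while
ln (N + 1) <= N and ln 4 <= 3 / 2 bound the others by (5 / 2) x / k, and
5 / 2 < 2 * 1.25507.  The hypothesis x >= k (k + 1) serves to give N >= k > l,
which puts the first term l of the progression among the small primes. *)

(** * Products of primes *)

Lemma prime_ndvd_fact (p n : nat) : prime p -> (n < p)%N -> ~~ (p %| n`!)%N.
Proof.
move=> pr_p; elim: n => [|n IHn] lt_np.
  by rewrite dvdn1 neq_ltn prime_gt1 ?orbT.
by rewrite factS Euclid_dvdM // negb_or gtnNdvd // IHn // ltnW.
Qed.

Lemma prod_primes_dvd (s : seq nat) (P : pred nat) (a : nat) :
    uniq s -> (forall p, p \in s -> P p -> prime p && (p %| a)%N) ->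
  (\prod_(p <- s | P p) p %| a)%N.
Proof.
elim: s => [|q s IHs] /=; first by rewrite big_nil dvd1n.
move=> /andP[q_notin_s uniq_s] Pdvd; rewrite big_cons.
have Pdvd_s p : p \in s -> P p -> prime p && (p %| a)%N.
  by move=> p_s; apply: Pdvd; rewrite inE p_s orbT.
case: ifP => [Pq|_]; last exact: IHs.
have /andP[pr_q q_dvd] := Pdvd q (mem_head _ _) Pq.
rewrite Gauss_dvd ?q_dvd ?IHs // prime_coprime // Euclid_dvd_prod //.
rewrite big_has_cond; apply/hasPn => p p_s; apply/andP => -[Pp].
have /andP[pr_p _] := Pdvd_s p p_s Pp.
by rewrite dvdn_prime2 // => /eqP qp; rewrite qp p_s in q_notin_s.
Qed.

(** ['C(2 m + 1, m)] occurs twice in the expansion of [(1 + 1) ^ (2 m + 1)]. *)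
Lemma central_bin_le (m : nat) : ('C(m.*2.+1, m) <= 4 ^ m)%N.
Proof.
rewrite -(leq_pmul2l (isT : (0 < 2)%N)) (_ : 4 = 2 ^ 2)%N // -expnM -expnS.
rewrite -[X in (_ <= X ^ _)%N]/(1 + 1)%N expnDn.
have lt_m : (m < (2 * m).+2)%N by lia.
have lt_m1 : (m.+1 < (2 * m).+2)%N by lia.
rewrite (bigD1 (Ordinal lt_m)) //= (bigD1 (Ordinal lt_m1)) /=; last first.
  by rewrite -val_eqE /= neq_ltn ltnSn orbT.
rewrite !exp1n !muln1 addnA -[X in (_ + X + _)%N]bin_sub; last by lia.
rewrite (_ : (2 * m).+1 - m.+1 = m)%N; last by lia.
by rewrite -mul2n mul2n -mul2n mulSn mul1n leq_addr.
Qed.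

(** Strong induction on n.  An even n > 2 contributes no new prime.  If
n = 2 m + 1, the primes in the interval from m + 2 to n divide ['C(n, m)],
which is at most [4 ^ m], and the primes up to m + 1 are handled by
induction. *)
Lemma primorial_le (n : nat) : (\prod_(0 <= p < n.+1 | prime p) p <= 4 ^ n)%N.
Proof.
elim/ltn_ind: n => n IHn.
have [|] := leqP n 2.
  by case: n IHn => [|[|[|]]] //= _ _; rewrite unlock.
move=> n_gt2.
case: (boolP (odd n)) => odd_n; last first.
  have npr : ~~ prime n.
    by apply: contra odd_n => /even_prime [n2|//]; rewrite n2 in n_gt2.
  rewrite big_mkcond big_nat_recr //= (negPf npr) muln1 -big_mkcond.
  case: n n_gt2 IHn {odd_n npr} => // n _ IHn.
  by apply: leq_trans (IHn n _) _ => //; rewrite leq_exp2l.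
have [m def_n] : exists m, n = m.*2.+1.
  by exists n./2; rewrite -[LHS]odd_double_half odd_n add1n.
rewrite {}def_n in IHn n_gt2 *.
rewrite (@big_cat_nat _ _ _ m.+2) //=; last by lia.
have -> : (4 ^ m.*2.+1 = 4 ^ m.+1 * 4 ^ m)%N.
  by rewrite -expnD; congr (_ ^ _)%N; lia.
apply: leq_mul; first by apply: IHn; lia.
apply: leq_trans (central_bin_le m); apply: dvdn_leq.
  by rewrite bin_gt0; lia.
apply: prod_primes_dvd; first exact: iota_uniq.
move=> p; rewrite mem_index_iota => /andP[m_lt p_le] pr_p; rewrite pr_p /=.
have : (p %| (m.*2.+1)`!)%N by apply: dvdn_fact; rewrite prime_gt0.
rewrite -(@bin_fact m.*2.+1 m); last by lia.
rewrite (_ : m.*2.+1 - m = m.+1)%N; last by lia.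
rewrite Euclid_dvdM // [X in _ || X]Euclid_dvdM //.
by rewrite !(negPf (prime_ndvd_fact _ _ pr_p _)) ?orbF // ltnW.
Qed.

(** * Factorials and products of terms of a progression *)

(** The sum in Legendre's formula telescopes once multiplied by [p - 1]: each
[(p - 1) * (n %/ p ^ (i + 1))] is at most the difference of the consecutive
terms [n %/ p ^ i] and [n %/ p ^ (i + 1)]. *)
Lemma logn_fact_le (p n : nat) : prime p -> (logn p n`! * p.-1 <= n)%N.
Proof.
move=> pr_p; rewrite logn_fact //.
suff H m : ((\sum_(1 <= i < m.+1) n %/ p ^ i) * p.-1 + n %/ p ^ m <= n)%N.
  exact: leq_trans (leq_addr _ _) (H n).
elim: m => [|m IHm]; first by rewrite big_geq // expn0 divn1.
rewrite big_nat_recr //=; apply: leq_trans IHm.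
rewrite mulnDl -addnA leq_add2l addnC -mulnS prednK ?prime_gt0 //.
by rewrite expnSr divnMA leq_trunc_div.
Qed.

Lemma modn_prod (I : Type) (s : seq I) (F G : I -> nat) (d : nat) :
    (forall i, F i = G i %[mod d]) ->
  (\prod_(i <- s) F i = \prod_(i <- s) G i %[mod d])%N.
Proof.
move=> eqFG; elim/big_rec2: _ => // i a b _ eq_ab.
by rewrite -modnMm eqFG eq_ab modnMm.
Qed.

(** Modulo d the common difference k is invertible, so the Chinese remainder
theorem gives t with [t * k] congruent to l.  The product is then congruent to
[k ^ n] times [(t + 1) ... (t + n)], which is [n`!] times a binomial
coefficient. *)
Lemma dvd_prod_progression (d n k l : nat) : coprime d k -> (d %| n`!)%N ->
  (d %| \prod_(1 <= j < n.+1) (l + j * k))%N.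
Proof.
move=> co_dk d_dvd; pose c := chinese d k l 0.
have /dvdnP[t def_c] : (k %| c)%N.
  by rewrite /dvdn -[X in _ == X](mod0n k) chinese_modr.
have -> : (d %| \prod_(1 <= j < n.+1) (l + j * k))%N
        = (d %| \prod_(1 <= j < n.+1) ((t + j) * k))%N.
  rewrite /dvdn; congr (_ == _); apply: modn_prod => j.
  by rewrite mulnDl -def_c -modnDml -(chinese_modl co_dk l 0) modnDml.
rewrite big_split /=; apply: dvdn_mulr; apply: dvdn_trans d_dvd _.
have -> : (\prod_(1 <= j < n.+1) (t + j) = (t + n) ^_ n)%N.
  elim: n => [|n IHn]; first by rewrite big_geq.
  by rewrite big_nat_recr //= IHn addnS ffactSS mulnC.
by rewrite -bin_ffact dvdn_mull.
Qed.

Lemma prod_progression_le (n k l : nat) : (l <= k)%N ->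
  (\prod_(1 <= j < n.+1) (l + j * k) <= k ^ n * n.+1`!)%N.
Proof.
move=> le_lk; elim: n => [|n IHn]; first by rewrite big_geq.
rewrite big_nat_recr //=.
have -> : (k ^ n.+1 * n.+2`! = k ^ n * n.+1`! * (n.+2 * k))%N.
  by rewrite factS expnSr [(n.+2 * _)%N]mulnC mulnACA [(k * _)%N]mulnC.
by rewrite leq_mul // mulSn leq_add2r.
Qed.

(** In the classical case of difference 1, the binomial coefficient with
denominator [n`!] is divisible by every prime of its numerator that exceeds n.
For difference k, only the part of [n`!] prime to k is known to divide the
product of the terms; the lost part is the factor [k ^ logn k n`!]. *)
Lemma prod_large_primes_le (k l n b : nat) (P : pred nat) :
    prime k -> (l <= k)%N ->
    (forall p, (n < p < b)%N -> P p ->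
       prime p && (p %| \prod_(1 <= j < n.+1) (l + j * k))%N) ->
  (\prod_(n.+1 <= p < b | P p) p <= k ^ n * n.+1 * k ^ logn k n`!)%N.
Proof.
move=> pr_k le_lk Pdvd; set B := (X in (X <= _)%N).
pose A := (\prod_(1 <= j < n.+1) (l + j * k))%N; pose d := (n`!`_k^')%N.
have n_gt0 := fact_gt0 n.
have B_dvd : (B %| A)%N.
  apply: prod_primes_dvd; first exact: iota_uniq.
  by move=> p; rewrite mem_index_iota; apply: Pdvd.
have d_dvd_fact : (d %| n`!)%N by apply: dvdn_part.
have d_dvd : (d %| A)%N.
  apply: dvd_prod_progression d_dvd_fact.
  by rewrite coprime_sym; apply: (@pnat_coprime k); rewrite ?part_pnat ?pnat_id.
have co_Bd : coprime B d.
  apply: coprime_dvdr d_dvd_fact _; rewrite /B big_nat_cond.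
  apply: (big_ind (fun a => coprime a n`!)); first exact: coprime1n.
    by move=> a c; rewrite coprimeMl => -> ->.
  move=> p /andP[lt_np Pp]; have /andP[pr_p _] := Pdvd p lt_np Pp.
  by rewrite prime_coprime // prime_ndvd_fact //; case/andP: lt_np.
have A_gt0 : (0 < A)%N.
  rewrite /A big_nat_cond prodn_cond_gt0 // => j /andP[/andP[j_gt0 _] _].
  by rewrite addn_gt0 muln_gt0 j_gt0 (prime_gt0 pr_k) orbT.
have le_BdA : (B * d <= A)%N by rewrite dvdn_leq // Gauss_dvd // B_dvd.
(* After multiplication by n! = k ^ v * d, both sides have the factor k ^ v, and
   A lies between what remains of each. *)
rewrite -(leq_pmul2r n_gt0) -[X in (_ * X <= _)%N](partnC k n_gt0) -/d p_part.
rewrite mulnCA mulnC.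
apply: leq_trans (_ : A * k ^ logn k n`! <= _)%N.
  by rewrite leq_mul2r le_BdA orbT.
rewrite mulnAC leq_mul2r; apply/orP; right.
by rewrite -mulnA -factS prod_progression_le.
Qed.

Lemma prod_primes_progression_le (X l k : nat) (N := ((X - l) %/ k)%N) :
    prime k -> (l <= k)%N -> (l <= N)%N ->
  (\prod_(0 <= p < X.+1 | [&& prime p, (l <= p)%N & p == l %[mod k]]) p
     <= 4 ^ N * (k ^ N * N.+1 * k ^ logn k N`!))%N.
Proof.
move=> pr_k le_lk le_lN; have k_gt0 := prime_gt0 pr_k.
have le_NX : (N.+1 <= X.+1)%N.
  by rewrite ltnS (leq_trans (leq_div _ _)) // leq_subr.
rewrite (@big_cat_nat _ _ _ N.+1) //=; apply: leq_mul.
  apply: leq_trans (primorial_le N); rewrite big_mkcondr leq_prod // => p pr_p.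
  by case: ifP => // _; rewrite prime_gt0.
apply: (prod_large_primes_le k l) => // p /andP[lt_Np le_pX].
move=> /and3P[pr_p le_lp p_mod].
rewrite pr_p /=; have /dvdnP[j def_j] : (k %| p - l)%N by rewrite -eqn_mod_dvd.
have def_p : p = (l + j * k)%N by rewrite -def_j subnKC.
have j_gt0 : (0 < j)%N.
  (* j = 0 would mean p = l, but l <= N < p. *)
  by rewrite lt0n; apply: contraTneq lt_Np => j0; rewrite def_p j0 addn0 -leqNgt.
have le_jN : (j <= N)%N by rewrite leq_divRL // -def_j leq_sub2r.
rewrite (bigD1_seq j) ?iota_uniq ?mem_index_iota ?j_gt0 ?ltnS //=.
by rewrite -def_p dvdn_mulr.
Qed.

(** * Passage to logarithms *)

Lemma theta_ln_prod (R : realType) (x : R) (k l : nat) :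
  theta x k l = ln ((\prod_(0 <= p < (Num.truncn x).+1
    | [&& prime p, (l <= p)%N & p == l %[mod k]]) p)%N%:R).
Proof.
rewrite /theta.
set s := index_iota _ _.
set P := fun p : nat => [&& prime p, (l <= p)%N & p == l %[mod k]].
suff [] : \sum_(p <- s | P p) ln p%:R = ln ((\prod_(p <- s | P p) p)%N%:R : R)
    /\ (0 < \prod_(p <- s | P p) p)%N by [].
apply: (big_ind2 (fun (a : R) (b : nat) => a = ln b%:R /\ (0 < b)%N)).
- by rewrite ln1.
- move=> a b c d [-> b_gt0] [-> d_gt0].
  by rewrite natrM lnM ?posrE ?ltr0n // muln_gt0 b_gt0.
by move=> p /and3P[pr_p _ _]; rewrite prime_gt0.
Qed.

(** From [1 + u <= expR u] at [u = 3 / 32]: the eighth power of [35 / 32] is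
about 2.048. *)
Lemma ln2_le (R : realType) : ln (2 : R) <= 3 / 4.
Proof.
rewrite -[leRHS]expRK ler_ln ?posrE ?expR_gt0 //.
have -> : 3 / 4 = 8%:R * (3 / 32) :> R by lra.
rewrite expRM_natl.
apply: le_trans (_ : (1 + 3 / 32) ^+ 8 <= _); first by lra.
by rewrite lerXn2r ?nnegrE ?expR_ge0 ?expR_ge1Dx //; lra.
Qed.

Theorem corollary1p5 (R : realType) (l k : nat) (x : R)
    (hl : (0 < l)%N) (hk : prime k) (hlk : (l < k)%N)
    (hx : k%:R * (k%:R + 1) <= x) :
  theta x k l <= x * (2 * c3 R / k%:R + ln k%:R / (k%:R - 1)).
Proof.
have k_gt1 := prime_gt1 hk; have k_gt0 := prime_gt0 hk.
have x_ge0 : 0 <= x by apply: le_trans hx; rewrite mulr_ge0 // addr_ge0.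
set X := Num.truncn x; pose N := ((X - l) %/ k)%N.
have le_kX : (k * k.+1 <= X)%N.
  by rewrite truncn_ge_nat // natrM -natr1.
have le_lN : (l <= N)%N.
  by apply: leq_trans (ltnW hlk) _; rewrite leq_divRL //; nia.
have le_Nk : (N%:R * k%:R <= x).
  rewrite -natrM; apply: le_trans (_ : X%:R <= _); last by rewrite truncn_le.
  by rewrite ler_nat (leq_trans (leq_trunc_div _ _)) // leq_subr.
have kR_gt1 : 1 < k%:R :> R by rewrite ltr1n.
have kR_gt0 : 0 < k%:R :> R by rewrite ltr0n.
have lnk_ge0 : 0 <= ln k%:R :> R by rewrite ln_ge0 // ltW.
set v := logn k N`!.
have le_v : v%:R <= N%:R / (k%:R - 1) :> R.
  rewrite ler_pdivlMr ?subr_gt0 // (_ : _ - 1 = k.-1%:R); last first.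
    by rewrite -subn1 natrB.
  by rewrite -natrM ler_nat logn_fact_le.
have le_theta : theta x k l
    <= N%:R * ln 4 + (N%:R * ln k%:R + ln N.+1%:R + v%:R * ln k%:R).
  rewrite [leRHS](_ : _ = ln ((4 ^ N * (k ^ N * N.+1 * k ^ v))%N%:R)); last first.
    rewrite !natrM !natrX !lnM ?posrE ?mulr_gt0 ?exprn_gt0 ?ltr0n //.
    rewrite !lnXn ?ltr0n //.
    by rewrite -!(mulr_natl (ln _)).
  rewrite theta_ln_prod ler_ln ?posrE ?ltr0n.
  - by rewrite ler_nat; apply: prod_primes_progression_le => //; apply: ltnW.
  - by rewrite prodn_cond_gt0 // => p /and3P[/prime_gt0].
  - by rewrite !muln_gt0 !expn_gt0 k_gt0.
have ln4_le : ln (4 : R) <= 3 / 2.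
  rewrite (_ : 4 = 2 ^+ 2); last by ring.
  by rewrite lnXn // mulr2n; have := ln2_le R; lra.
have lnN_le : ln N.+1%:R <= N%:R :> R.
  by rewrite -natr1 addrC le_ln1Dx // (lt_le_trans (ltrN10 _)).
have N_ge0 : 0 <= N%:R :> R by [].
have le_N : N%:R <= x / k%:R by rewrite ler_pdivlMr.
have le_c3 : 5 / 2 <= 2 * c3 R by rewrite /c3; lra.
have part1 : N%:R * ln 4 + ln N.+1%:R <= x * (2 * c3 R / k%:R).
  rewrite (_ : x * _ = x / k%:R * (2 * c3 R)); last by ring.
  apply: le_trans (_ : N%:R * (5 / 2) <= _); first by nra.
  by apply: ler_pM => //; lra.
have part2 : N%:R * ln k%:R + v%:R * ln k%:R <= x * (ln k%:R / (k%:R - 1)).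
  rewrite -mulrDl mulrCA mulrC ler_wpM2l //.
  apply: le_trans (_ : N%:R + N%:R / (k%:R - 1) <= _); first by rewrite lerD2l.
  have -> : N%:R + N%:R / (k%:R - 1) = N%:R * k%:R / (k%:R - 1) :> R.
    by field; lra.
  by rewrite ler_wpM2r // invr_ge0 subr_ge0 ltW.
by rewrite mulrDr; lra.
Qed.
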